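(* Let $\beta$ be a positive number. (1) For every $k\in\mathbb{N}$ and every $x\in(0,\infty)$, $$\ln x-\frac1x\le\psi(x)\le\ln x-\frac1{2x}$$ and $$\frac{(k-1)!}{x^k}+\frac{k!}{2x^{k+1}}\le(-1)^{k+1}\psi^{(k)}(x)\le\frac{(k-1)!}{x^k}+\frac{k!}{x^{k+1}}.$$ (2) When $\beta>0$, for every $x\in(0,\infty)$ and every integer $k\ge2$, $$\psi(x+\beta)\le\ln x+\frac{\beta}{x}$$ and $$(-1)^{k}\psi^{(k-1)}(x+\beta)\ge\frac{(k-2)!}{x^{k-1}}-\frac{\beta\,(k-1)!}{x^{k}}.$$ (3) When $\beta\ge\frac12$, for every $x\in(0,\infty)$ and every integer $k\ge2$, $$\psi(x+\beta)\ge\ln x\quad\text{and}\quad(-1)^{k}\psi^{(k-1)}(x+\beta)\le\frac{(k-2)!}{x^{k-1}}.$$ (4) When $\beta\ge1$, for every $x\in(0,\infty)$ and every integer $k\ge2$, $$\psi(x+\beta)\le\ln x+\frac{\beta-1/2}{x}$$ and $$(-1)^{k}\psi^{(k-1)}(x+\beta)\ge\frac{(k-2)!}{x^{k-1}}-\frac{(\beta-1/2)(k-1)!}{x^{k}}.$$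
   Context: $\Gamma$ denotes the classical Euler gamma function, $\Gamma(x)=\int_0^\infty t^{x-1}e^{-t}\,dt$ for $x>0$. The psi function is its logarithmic derivative, $\psi(x)=\Gamma'(x)/\Gamma(x)$, and $\psi^{(k)}$ for $k\in\mathbb{N}=\{1,2,3,\dots\}$ denotes the $k$-th derivative of $\psi$ (the polygamma functions). *)

(* Defs.v *)
From Stdlib Require Import Reals.
From Coquelicot Require Import Coquelicot.
Open Scope R_scope.

(* Meaningful for [0 < x]; the integral is improper at both endpoints, as
   [Rpower t (x - 1)] is singular at [t = 0] when [x < 1]. *)
Definition Gamma (x : R) : R :=
  RInt_gen (fun t : R => Rpower t (x - 1) * exp (- t))
    (at_right 0) (Rbar_locally p_infty).

Definition psi (x : R) : R := Derive Gamma x / Gamma x.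

Definition polygamma (k : nat) (x : R) : R := Derive_n psi k x.

(* Main.v *)
(* Let [lgamma] be the series of [(x-1) ln((n+2)/(n+1)) - ln((x+n)/(1+n))], which
   satisfies [lgamma(x+1) = lgamma(x) + ln x] and can be differentiated termwise:
   its second derivative is [sum_n 1/(x+n)^2]. As in the Bohr-Mollerup theorem,
   [ln Gamma - lgamma] is 1-periodic, and Wendel's inequality
   [Gamma(y+s) <= y^s Gamma(y)] for [0 <= s <= 1] makes its increments tend to 0 at
   infinity; so it is constant and
   [psi^(k)(x) = (-1)^(k+1) k! sum_n 1/(x+n)^(k+1)], with no differentiation under
   the integral sign.

   The bounds then hold term by term after telescoping [1/(x+n)^k] and [ln(x+n)]:
   the tangent, trapezoid and midpoint inequalities for the convex function
   [t^(-k)] on [x+n, x+n+1] give the constants 1, 1/2 and the shift 1/2. Part (4)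
   is the tangent inequality at [x+1] combined with part (3) for [beta = 1]. *)
Require Import Defs.
From Stdlib Require Import Reals Arith Lra Lia.
From Coquelicot Require Import Coquelicot.
Open Scope R_scope.

(** * Series and termwise differentiation *)

(** This and the next four lemmas fix the normed module to [R], so that goals show real [+], [-] and
    [*], which [ring] and [lra] understand. *)
Lemma is_series_ext_R (a b : nat -> R) (l : R) :
  (forall n, a n = b n) -> is_series a l -> is_series b l.
Proof. apply is_series_ext. Qed.

Lemma is_series_plus_R (a b : nat -> R) (la lb : R) :
  is_series a la -> is_series b lb -> is_series (fun n => a n + b n) (la + lb).
Proof. apply (is_series_plus (V := R_NormedModule)). Qed.

Lemma is_series_minus_R (a b : nat -> R) (la lb : R) :
  is_series a la -> is_series b lb -> is_series (fun n => a n - b n) (la - lb).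
Proof. apply (is_series_minus (V := R_NormedModule)). Qed.

Lemma is_series_opp_R (a : nat -> R) (la : R) :
  is_series a la -> is_series (fun n => - a n) (- la).
Proof. apply (is_series_opp (V := R_NormedModule)). Qed.

Lemma is_series_scal_l_R (c : R) (a : nat -> R) (la : R) :
  is_series a la -> is_series (fun n => c * a n) (c * la).
Proof. apply (is_series_scal_l (V := R_NormedModule)). Qed.

Lemma is_series_telescope (v : nat -> R) (l : R) :
  is_lim_seq v l -> is_series (fun n => v n - v (S n)) (v O - l).
Proof.
intros Hv.
apply (filterlim_ext (fun n => v O - v (S n))).
- intros n; induction n as [|n IH].
  + now rewrite sum_O.
  + rewrite sum_Sn, <- IH; unfold plus; simpl; ring.
- apply (is_lim_seq_minus' (fun _ => v O)).
  + apply is_lim_seq_const.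
  + now apply is_lim_seq_incr_1 in Hv.
Qed.

Lemma is_series_le (a b : nat -> R) (la lb : R) :
  is_series a la -> is_series b lb -> (forall n, a n <= b n) -> la <= lb.
Proof.
intros Ha Hb Hab.
apply (is_lim_seq_le (sum_n a) (sum_n b) la lb); trivial.
intros n; now apply sum_n_m_le.
Qed.

Lemma shift_pos (x : R) (n : nat) : 0 < x -> 0 < x + INR n.
Proof. intros Hx; generalize (pos_INR n); lra. Qed.

Lemma is_lim_seq_inv_shift_pow (x : R) (m : nat) :
  0 < x -> is_lim_seq (fun n => / (x + INR n) ^ S m) 0.
Proof.
intros Hx.
assert (H1 : is_lim_seq (fun n => / (x + INR n)) 0).
{ apply (is_lim_seq_inv _ p_infty); [|discriminate].
  apply (is_lim_seq_plus _ _ x p_infty); [apply is_lim_seq_const|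
    apply is_lim_seq_INR|reflexivity]. }
induction m as [|m IH].
- apply is_lim_seq_ext with (2 := H1); intros n; f_equal; ring.
- apply is_lim_seq_ext with (fun n => / (x + INR n) * / (x + INR n) ^ S m).
  + intros n; rewrite <- Rinv_mult; f_equal.
  + replace (Finite 0) with (Finite (0 * 0)) by (f_equal; ring).
    now apply is_lim_seq_mult'.
Qed.

Lemma is_series_telescope_inv_pow (x : R) (m : nat) :
  0 < x ->
  is_series (fun n => / (x + INR n) ^ S m - / (x + INR n + 1) ^ S m)
    (/ x ^ S m).
Proof.
intros Hx.
replace (/ x ^ S m) with (/ (x + INR 0) ^ S m - 0)
  by (simpl INR; rewrite Rplus_0_r; ring).
eapply is_series_ext_R;
  [|apply (is_series_telescope (fun n => / (x + INR n) ^ S m));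
    now apply is_lim_seq_inv_shift_pow].
intros n; cbv beta; rewrite S_INR, Rplus_assoc; reflexivity.
Qed.

(** Comparison with a telescoping series: for [z = x + INR n >= x], [/ z ^ m <= / x ^ m], and
    [/ z ^ 2] is at most [(x + 1) / x] times [/ z - / (z + 1)]. *)
Lemma ex_series_inv_pow (x : R) (m : nat) :
  0 < x -> ex_series (fun n => / (x + INR n) ^ S (S m)).
Proof.
intros Hx.
apply (ex_series_le (V := R_CompleteNormedModule) _
  (fun n => scal ((x + 1) / x * / x ^ m)
     (/ (x + INR n) ^ 1 - / (x + INR n + 1) ^ 1))).
2: { apply (ex_series_scal (V := R_NormedModule)); exists (/ x ^ 1).
     now apply is_series_telescope_inv_pow. }
intros n; pose proof (shift_pos x n Hx) as Hn; pose proof (pos_INR n) as Hn0.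
set (z := x + INR n) in *.
assert (Hzm : 0 < z ^ m) by now apply pow_lt.
assert (Hxm : 0 < x ^ m) by now apply pow_lt.
assert (Hle : / z ^ m <= / x ^ m).
{ apply Rinv_le_contravar; trivial; apply pow_incr; unfold z; lra. }
unfold norm, scal; simpl; unfold abs, mult; simpl.
rewrite Rabs_pos_eq.
2: { apply Rlt_le, Rinv_0_lt_compat; repeat apply Rmult_lt_0_compat; trivial. }
replace (/ (z * (z * z ^ m))) with (/ (z * z) * / z ^ m) by (field; lra).
replace ((x + 1) / x * / x ^ m * (/ (z * 1) - / ((z + 1) * 1)))
  with (((x + 1) / x * / (z * (z + 1))) * / x ^ m) by (field; lra).
apply Rmult_le_compat; trivial.
- apply Rlt_le, Rinv_0_lt_compat; nra.
- now apply Rlt_le, Rinv_0_lt_compat.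
- apply (Rmult_le_reg_l (x * z * z * (z + 1))).
  { repeat apply Rmult_lt_0_compat; lra. }
  replace (x * z * z * (z + 1) * / (z * z)) with (x * (z + 1)) by (field; lra).
  replace (x * z * z * (z + 1) * ((x + 1) / x * / (z * (z + 1))))
    with (z * (x + 1)) by (field; lra).
  unfold z; nra.
Qed.

Lemma is_derive_continuity_pt (f : R -> R) (x l : R) :
  is_derive f x l -> continuity_pt f x.
Proof.
intros H; apply continuity_pt_filterlim.
apply (ex_derive_continuous (V := R_NormedModule)); now exists l.
Qed.

(* The quadratic remainder bound replaces the uniform convergence of the
   differentiated series. *)
Lemma is_derive_Series (f g h : nat -> R -> R) (M : nat -> R) (a x : R) :
  a < x ->
  (forall n y, a < y -> is_derive (f n) y (g n y)) ->
  (forall n y, a < y -> is_derive (g n) y (h n y)) ->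
  (forall n y, a < y -> Rabs (h n y) <= M n) ->
  ex_series M ->
  (forall y, a < y -> ex_series (fun n => f n y)) ->
  ex_series (fun n => g n x) ->
  is_derive (fun y => Series (fun n => f n y)) x (Series (fun n => g n x)).
Proof.
intros Hax Hf Hg Hh HM Hsf Hsg.
(* Two mean value steps: the remainder is [(g n c - g n x) * (y - x)], which is
   [h n d * (c - x) * (y - x)], and [c] lies between [x] and [y]. *)
assert (Hrem : forall n y, a < y ->
  Rabs (f n y - f n x - (y - x) * g n x) <= M n * (y - x) ^ 2).
{ intros n y Hy.
  assert (Hmin : forall u v w, a < u -> a < v -> Rmin u v <= w -> a < w).
  { intros u v w Hu Hv; unfold Rmin; destruct (Rle_dec u v); lra. }
  destruct (MVT_gen (f n) x y (g n)) as [c [Hc Ec]].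
  { intros z Hz; apply Hf, (Hmin x y); trivial; lra. }
  { intros z Hz; apply (is_derive_continuity_pt _ _ (g n z)), Hf, (Hmin x y); trivial; lra. }
  assert (Hac : a < c) by (apply (Hmin x y); trivial; lra).
  destruct (MVT_gen (g n) x c (h n)) as [d [Hd Ed]].
  { intros z Hz; apply Hg, (Hmin x c); trivial; lra. }
  { intros z Hz; apply (is_derive_continuity_pt _ _ (h n z)), Hg, (Hmin x c); trivial; lra. }
  replace (f n y - f n x - (y - x) * g n x) with ((g n c - g n x) * (y - x))
    by (rewrite Ec; ring).
  rewrite Ed, !Rabs_mult, Rmult_assoc.
  apply Rmult_le_compat; [apply Rabs_pos|
    apply Rmult_le_pos; apply Rabs_pos| |].
  - apply Hh, (Hmin x c); trivial; lra.
  - replace ((y - x) ^ 2) with (Rabs (y - x) * Rabs (y - x)).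
    2: { rewrite <- Rabs_mult, Rabs_pos_eq; [ring|apply Rle_0_sqr]. }
    apply Rmult_le_compat_r; [apply Rabs_pos|].
    destruct Hc as [Hc1 Hc2]; revert Hc1 Hc2.
    unfold Rmin, Rmax; destruct (Rle_dec x y); intros;
      unfold Rabs; do 2 destruct Rcase_abs; lra. }
pose proof (Series_correct _ HM) as HMs.
set (SM := Series M) in *.
assert (HM0 : forall n, 0 <= M n).
{ intros n; apply Rle_trans with (2 := Hh n x Hax), Rabs_pos. }
assert (HSM : 0 <= SM).
{ apply (is_series_le (fun _ => 0) M); trivial.
  generalize (is_series_telescope (fun _ => 0) 0 (is_lim_seq_const 0)).
  now rewrite Rminus_0_r. }
assert (Hmain : forall y, a < y ->
  Rabs (Series (fun n => f n y) - Series (fun n => f n x)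
        - (y - x) * Series (fun n => g n x)) <= SM * (y - x) ^ 2).
{ intros y Hy.
  pose proof (Series_correct _ (Hsf y Hy)) as H1.
  pose proof (Series_correct _ (Hsf x Hax)) as H2.
  pose proof (Series_correct _ Hsg) as H3.
  pose proof (is_series_minus_R _ _ _ _ (is_series_minus_R _ _ _ _ H1 H2)
                (is_series_scal_l_R (y - x) _ _ H3)) as H4.
  pose proof (is_series_scal_r ((y - x) ^ 2) _ _ HMs) as H5.
  pose proof (is_series_opp_R _ _ H5) as H6.
  apply Rabs_le; split.
  - apply (is_series_le _ _ _ _ H6 H4); intros n.
    generalize (Hrem n y Hy); intros Hn; apply Rabs_le_between in Hn; lra.
  - apply (is_series_le _ _ _ _ H4 H5); intros n.
    generalize (Hrem n y Hy); intros Hn; apply Rabs_le_between in Hn; lra. }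
apply is_derive_Reals; intros eps Heps.
(* The first bound keeps [x + k] above [a]; the second makes [SM * Rabs k < eps], with [SM + 1]
   avoiding division by zero. *)
assert (Hd : 0 < Rmin (x - a) (eps / (SM + 1))).
{ apply Rmin_glb_lt; [lra|apply Rdiv_lt_0_compat; lra]. }
exists (mkposreal _ Hd); intros k Hk Hkd; simpl in Hkd.
pose proof (Rmin_l (x - a) (eps / (SM + 1))).
pose proof (Rmin_r (x - a) (eps / (SM + 1))).
assert (Hy : a < x + k).
{ apply Rabs_def2 in Hkd; lra. }
specialize (Hmain (x + k) Hy).
set (F := Series (fun n => f n (x + k)) - Series (fun n => f n x)) in *.
set (G := Series (fun n => g n x)) in *.
replace (x + k - x) with k in Hmain by ring.
replace (F / k - G) with ((F - k * G) / k) by (field; trivial).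
unfold Rdiv; rewrite Rabs_mult, Rabs_inv.
assert (Hk0 : 0 < Rabs k) by now apply Rabs_pos_lt.
apply Rle_lt_trans with (SM * Rabs k).
- apply (Rmult_le_reg_r (Rabs k)); trivial.
  rewrite Rmult_assoc, Rinv_l, Rmult_1_r by lra.
  replace (k ^ 2) with (Rabs k * Rabs k) in Hmain; [lra|].
  rewrite <- Rabs_mult, Rabs_pos_eq; [ring|apply Rle_0_sqr].
- apply Rle_lt_trans with ((SM + 1) * Rabs k); [nra|].
  apply (Rmult_lt_reg_r (/ (SM + 1))); [apply Rinv_0_lt_compat; lra|].
  replace ((SM + 1) * Rabs k * / (SM + 1)) with (Rabs k) by (field; lra).
  unfold Rdiv in *; lra.
Qed.

(** * Hurwitz zeta, digamma and log-gamma series *)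

(** The Hurwitz zeta function at an integer exponent. The series diverges for [m <= 1], which is why
    the lemmas below use exponents [S (S m)]. *)
Definition zeta (m : nat) (x : R) : R := Series (fun n => / (x + INR n) ^ m).

Lemma is_series_zeta (m : nat) (x : R) :
  0 < x -> is_series (fun n => / (x + INR n) ^ S (S m)) (zeta (S (S m)) x).
Proof. intros Hx; now apply Series_correct, ex_series_inv_pow. Qed.

Lemma is_derive_inv_pow (m : nat) (c y : R) :
  y + c <> 0 ->
  is_derive (fun t => / (t + c) ^ m) y (- INR m * / (y + c) ^ S m).
Proof.
intros H; destruct m as [|m].
- apply (is_derive_ext (fun _ => 1)); [intros t; simpl; field|].
  simpl INR; replace (- 0 * / (y + c) ^ 1) with 0 by ring.
  apply (is_derive_const (V := R_NormedModule)).
- auto_derive.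
  + now apply (pow_nonzero (y + c) (S m)).
  + change (match m with O => 1 | S _ => INR m + 1 end) with (INR (S m)).
    simpl pow; field; split; trivial; now apply pow_nonzero.
Qed.

Lemma inv_pow_le (m : nat) (x y : R) : 0 < x -> x <= y -> / y ^ m <= / x ^ m.
Proof.
intros Hx Hy; apply Rinv_le_contravar; [now apply pow_lt|apply pow_incr; lra].
Qed.

(** Termwise differentiation on the half-line [y > x / 2], where the second derivatives of the terms
    are dominated by their values at [x / 2]. *)
Lemma is_derive_zeta (m : nat) (x : R) :
  0 < x -> is_derive (zeta (S (S m))) x (- INR (S (S m)) * zeta (S (S (S m))) x).
Proof.
intros Hx; unfold zeta at 2; rewrite <- Series_scal_l.
apply (is_derive_Series (fun n y => / (y + INR n) ^ S (S m))
  (fun n y => - INR (S (S m)) * / (y + INR n) ^ S (S (S m)))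
  (fun n y => - INR (S (S m)) *
     (- INR (S (S (S m))) * / (y + INR n) ^ S (S (S (S m)))))
  (fun n => scal (INR (S (S m)) * INR (S (S (S m))))
     (/ (x / 2 + INR n) ^ S (S (S (S m))))) (x / 2)); try lra.
- intros n y Hy; apply is_derive_inv_pow.
  pose proof (shift_pos y n); lra.
- intros n y Hy; apply is_derive_scal, is_derive_inv_pow.
  pose proof (shift_pos y n); lra.
- intros n y Hy.
  change (Rabs (- INR (S (S m)) * (- INR (S (S (S m)))
    * / (y + INR n) ^ S (S (S (S m))))) <=
    INR (S (S m)) * INR (S (S (S m))) * / (x / 2 + INR n) ^ S (S (S (S m)))).
  pose proof (pos_INR (S (S m))); pose proof (pos_INR (S (S (S m)))).
  assert (Hp : 0 < / (y + INR n) ^ S (S (S (S m)))).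
  { apply Rinv_0_lt_compat, pow_lt, shift_pos; lra. }
  rewrite Rabs_pos_eq.
  + replace (- INR (S (S m)) * (- INR (S (S (S m)))
      * / (y + INR n) ^ S (S (S (S m))))) with
      (INR (S (S m)) * INR (S (S (S m))) * / (y + INR n) ^ S (S (S (S m)))) by ring.
    apply Rmult_le_compat_l; [now apply Rmult_le_pos|].
    apply inv_pow_le; [apply shift_pos|]; lra.
  + replace (- INR (S (S m)) * (- INR (S (S (S m)))
      * / (y + INR n) ^ S (S (S (S m))))) with
      (INR (S (S m)) * INR (S (S (S m))) * / (y + INR n) ^ S (S (S (S m)))) by ring.
    apply Rmult_le_pos; [now apply Rmult_le_pos|lra].
- apply (ex_series_scal (V := R_NormedModule)), ex_series_inv_pow; lra.
- intros y Hy; apply ex_series_inv_pow; lra.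
- apply (ex_series_scal (V := R_NormedModule)), ex_series_inv_pow; lra.
Qed.

Lemma ln_le_sub_1 (y : R) : 0 < y -> ln y <= y - 1.
Proof.
intros Hy; generalize (exp_ineq1_le (ln y)); rewrite exp_ln; lra.
Qed.

(** Both sides come from [ln t <= t - 1], at [t = y / x] and at [t = x / y]. *)
Lemma ln_sub_bounds (x y : R) :
  0 < x -> 0 < y -> (y - x) / y <= ln y - ln x <= (y - x) / x.
Proof.
intros Hx Hy.
assert (H : forall u v, 0 < u -> 0 < v -> ln u - ln v <= (u - v) / v).
{ intros u v Hu Hv; rewrite <- ln_div by trivial.
  replace ((u - v) / v) with (u / v - 1) by (field; lra).
  apply ln_le_sub_1, Rdiv_lt_0_compat; trivial. }
split; [|now apply H].
generalize (H x y Hx Hy).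
replace ((x - y) / y) with (- ((y - x) / y)) by (field; lra); lra.
Qed.

(** The logarithm increment in place of the usual [/ (n + 1)] absorbs Euler's constant into the
    series. *)
Definition dg_term (n : nat) (x : R) : R :=
  ln (INR n + 2) - ln (INR n + 1) - / (x + INR n).

Definition digamma (x : R) : R := Series (fun n => dg_term n x).

(* Normalized so that [lg_term n 1 = 0]; the partial sums of
   [lg_term n (x + 1) - lg_term n x] telescope to [ln x]. *)
Definition lg_term (n : nat) (x : R) : R :=
  (x - 1) * (ln (INR n + 2) - ln (INR n + 1)) - (ln (x + INR n) - ln (INR n + 1)).

Definition lgamma (x : R) : R := Series (fun n => lg_term n x).

(** Comparing with [/ (1 + INR n)] splits the term in two: a logarithmic error of at most
    [/ (1 + n) * / (2 + n)], and [(x - 1)] times a product of two reciprocals, bounded by the sum of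
    their squares. *)
Lemma dg_term_bound (n : nat) (x : R) : 0 < x ->
  Rabs (dg_term n x) <= / (1 + INR n) ^ 2
    + Rabs (x - 1) * (/ (1 + INR n) ^ 2 + / (x + INR n) ^ 2).
Proof.
intros Hx; unfold dg_term.
pose proof (pos_INR n) as Hn.
pose proof (shift_pos x n Hx) as Hz.
assert (H1 : 0 < 1 + INR n) by lra.
pose proof (ln_sub_bounds (INR n + 1) (INR n + 2) ltac:(lra) ltac:(lra)) as Hl.
replace (ln (INR n + 2) - ln (INR n + 1) - / (x + INR n)) with
  ((ln (INR n + 2) - ln (INR n + 1) - / (1 + INR n))
   + (x - 1) * (/ (1 + INR n) * / (x + INR n))) by (field; lra).
eapply Rle_trans; [apply Rabs_triang|]; apply Rplus_le_compat.
- replace ((INR n + 2 - (INR n + 1)) / (INR n + 1)) with (/ (1 + INR n))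
    in Hl by (field; lra).
  rewrite Rabs_left1 by lra.
  replace ((INR n + 2 - (INR n + 1)) / (INR n + 2)) with
    (/ (1 + INR n) - / (1 + INR n) * / (2 + INR n)) in Hl by (field; lra).
  assert (Hi : / (2 + INR n) <= / (1 + INR n)) by (apply Rinv_le_contravar; lra).
  assert (0 < / (1 + INR n)) by now apply Rinv_0_lt_compat.
  replace (/ (1 + INR n) ^ 2) with (/ (1 + INR n) * / (1 + INR n)) by (field; lra).
  nra.
- rewrite Rabs_mult; apply Rmult_le_compat_l; [apply Rabs_pos|].
  assert (0 < / (1 + INR n)) by now apply Rinv_0_lt_compat.
  assert (0 < / (x + INR n)) by now apply Rinv_0_lt_compat.
  replace (/ (1 + INR n) ^ 2) with (/ (1 + INR n) * / (1 + INR n)) by (field; lra).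
  replace (/ (x + INR n) ^ 2) with (/ (x + INR n) * / (x + INR n)) by (field; lra).
  rewrite Rabs_pos_eq by nra; nra.
Qed.

Lemma ex_series_dg_term_bound (x : R) : 0 < x ->
  ex_series (fun n => / (1 + INR n) ^ 2
    + Rabs (x - 1) * (/ (1 + INR n) ^ 2 + / (x + INR n) ^ 2)).
Proof.
intros Hx.
pose proof (ex_series_inv_pow 1 0 Rlt_0_1) as H1.
pose proof (ex_series_inv_pow x 0 Hx) as H2.
apply (ex_series_plus (V := R_NormedModule)); trivial.
apply (ex_series_scal (V := R_NormedModule)), (ex_series_plus (V := R_NormedModule));
  trivial.
Qed.

Lemma is_series_digamma (x : R) :
  0 < x -> is_series (fun n => dg_term n x) (digamma x).
Proof.
intros Hx; apply Series_correct.
apply (ex_series_le (V := R_CompleteNormedModule) _ _ (fun n => dg_term_bound n x Hx)).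
now apply ex_series_dg_term_bound.
Qed.

Lemma is_derive_dg_term (n : nat) (x : R) :
  0 < x -> is_derive (dg_term n) x (/ (x + INR n) ^ 2).
Proof.
intros Hx; pose proof (shift_pos x n Hx) as Hn; unfold dg_term.
auto_derive; [lra|field; lra].
Qed.

Lemma is_derive_lg_term (n : nat) (x : R) :
  0 < x -> is_derive (lg_term n) x (dg_term n x).
Proof.
intros Hx; pose proof (shift_pos x n Hx) as Hn; unfold lg_term, dg_term.
auto_derive; [lra|field; lra].
Qed.

Lemma Rmin_pos_le (a b c : R) : 0 < a -> 0 < b -> Rmin a b <= c -> 0 < c.
Proof.
intros Ha Hb Hc; apply Rlt_le_trans with (2 := Hc); now apply Rmin_glb_lt.
Qed.

Lemma MVT_pos (f df : R -> R) (x y : R) :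
  0 < x -> 0 < y -> (forall z, 0 < z -> is_derive f z (df z)) ->
  exists c, Rmin x y <= c <= Rmax x y /\ f y - f x = df c * (y - x).
Proof.
intros Hx Hy Hf; apply MVT_gen.
- intros z Hz; apply Hf, (Rmin_pos_le x y); trivial; lra.
- intros z Hz; apply (is_derive_continuity_pt _ _ (df z)), Hf, (Rmin_pos_le x y); trivial; lra.
Qed.

Lemma dg_term_incr (n : nat) (x y : R) :
  0 < x -> x <= y -> dg_term n x <= dg_term n y.
Proof.
intros Hx Hy; unfold dg_term.
assert (/ (y + INR n) <= / (x + INR n)); [|lra].
apply Rinv_le_contravar; [now apply shift_pos|lra].
Qed.

(** Since [lg_term n 1 = 0], the mean value theorem gives [lg_term n x = dg_term n c * (x - 1)]. As
    [dg_term n] is increasing, its value at [c] lies between those at [1] and [x], both summably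
    bounded. *)
Lemma ex_series_lg_term (x : R) : 0 < x -> ex_series (fun n => lg_term n x).
Proof.
intros Hx.
pose proof (ex_series_dg_term_bound x Hx) as H1.
pose proof (ex_series_dg_term_bound 1 Rlt_0_1) as H2.
pose proof (ex_series_scal (V := R_NormedModule) (Rabs (x - 1)) _
  (ex_series_plus (V := R_NormedModule) _ _ H1 H2)) as H3.
apply (fun H => ex_series_le (V := R_CompleteNormedModule) _ _ H H3).
intros n; cbv beta.
destruct (MVT_pos (lg_term n) (dg_term n) 1 x) as [c [Hc E]]; try lra.
{ intros; now apply is_derive_lg_term. }
assert (E1 : lg_term n 1 = 0).
{ unfold lg_term; rewrite (Rplus_comm 1); ring. }
rewrite E1, Rminus_0_r in E; rewrite E.
unfold norm, scal, plus; simpl; unfold abs, mult; simpl.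
rewrite Rabs_mult, Rmult_comm.
apply Rmult_le_compat_l; [apply Rabs_pos|].
pose proof (dg_term_bound n x Hx) as B1; simpl in B1.
pose proof (dg_term_bound n 1 Rlt_0_1) as B2; simpl in B2.
assert (B : dg_term n (Rmin 1 x) <= dg_term n c <= dg_term n (Rmax 1 x)).
{ assert (0 < Rmin 1 x) by (apply Rmin_glb_lt; lra).
  split; apply dg_term_incr; lra. }
apply Rabs_le_between in B1; apply Rabs_le_between in B2.
apply Rabs_le; revert B; unfold Rmin, Rmax; destruct (Rle_dec 1 x); intros; lra.
Qed.

Lemma is_derive_lgamma (x : R) : 0 < x -> is_derive lgamma x (digamma x).
Proof.
intros Hx.
apply (is_derive_Series lg_term dg_term (fun n y => / (y + INR n) ^ 2)
  (fun n => / (x / 2 + INR n) ^ 2) (x / 2)); try lra.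
- intros; apply is_derive_lg_term; lra.
- intros; apply is_derive_dg_term; lra.
- intros n y Hy; rewrite Rabs_pos_eq.
  + apply inv_pow_le; [apply shift_pos|]; lra.
  + apply Rlt_le, Rinv_0_lt_compat, pow_lt, shift_pos; lra.
- apply ex_series_inv_pow; lra.
- intros y Hy; apply ex_series_lg_term; lra.
- exists (digamma x); now apply is_series_digamma.
Qed.

Lemma is_derive_digamma (x : R) : 0 < x -> is_derive digamma x (zeta 2 x).
Proof.
intros Hx.
apply (is_derive_Series dg_term (fun n y => / (y + INR n) ^ 2)
  (fun n y => - INR 2 * / (y + INR n) ^ 3)
  (fun n => scal 2 (/ (x / 2 + INR n) ^ 3)) (x / 2)); try lra.
- intros; apply is_derive_dg_term; lra.
- intros n y Hy; apply is_derive_inv_pow.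
  pose proof (shift_pos y n); lra.
- intros n y Hy.
  assert (0 < / (y + INR n) ^ 3).
  { apply Rinv_0_lt_compat, pow_lt, shift_pos; lra. }
  assert (/ (y + INR n) ^ 3 <= / (x / 2 + INR n) ^ 3).
  { apply inv_pow_le; [apply shift_pos|]; lra. }
  change (Rabs (- 2 * / (y + INR n) ^ 3) <= 2 * / (x / 2 + INR n) ^ 3).
  rewrite Rabs_left1; lra.
- apply (ex_series_scal (V := R_NormedModule)), ex_series_inv_pow; lra.
- intros y Hy; exists (digamma y); apply is_series_digamma; lra.
- now apply ex_series_inv_pow.
Qed.

Lemma is_lim_seq_ln_shift (a b : R) :
  0 < a -> 0 < b -> is_lim_seq (fun n => ln (a + INR n) - ln (b + INR n)) 0.
Proof.
intros Ha Hb.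
assert (H : forall u v, 0 < u -> is_lim_seq (fun n => v / (u + INR n)) 0).
{ intros u v Hu; replace (Finite 0) with (Finite (v * 0)) by (f_equal; ring).
  apply is_lim_seq_mult'; [apply is_lim_seq_const|].
  apply is_lim_seq_ext with (2 := is_lim_seq_inv_shift_pow u 0 Hu).
  intros n; f_equal; ring. }
apply (is_lim_seq_le_le (fun n => (a - b) / (a + INR n)) _
  (fun n => (a - b) / (b + INR n))); try (now apply H).
intros n; generalize (ln_sub_bounds (b + INR n) (a + INR n)
  (shift_pos b n Hb) (shift_pos a n Ha)).
now replace (a + INR n - (b + INR n)) with (a - b) by ring.
Qed.

Lemma is_series_ln_telescope (a b : R) : 0 < a -> 0 < b ->
  is_series (fun n => (ln (a + INR n) - ln (b + INR n))
    - (ln (a + INR n + 1) - ln (b + INR n + 1))) (ln a - ln b).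
Proof.
intros Ha Hb.
generalize (is_series_telescope _ _ (is_lim_seq_ln_shift a b Ha Hb)).
cbv beta; change (INR 0) with 0; rewrite !Rplus_0_r, Rminus_0_r.
apply is_series_ext_R; intros n; cbv beta.
now rewrite S_INR, !Rplus_assoc.
Qed.

Lemma lgamma_succ (x : R) : 0 < x -> lgamma (x + 1) = lgamma x + ln x.
Proof.
intros Hx.
assert (H : is_series (fun n => lg_term n x +
  ((ln (x + INR n) - ln (1 + INR n))
    - (ln (x + INR n + 1) - ln (1 + INR n + 1)))) (lgamma x + (ln x - ln 1))).
{ apply (is_series_plus_R).
  - now apply Series_correct, ex_series_lg_term.
  - apply is_series_ln_telescope; lra. }
rewrite ln_1, Rminus_0_r in H; apply is_series_unique.
revert H; apply is_series_ext_R; intros n; unfold lg_term.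
replace (1 + INR n + 1) with (INR n + 2) by ring.
replace (x + 1 + INR n) with (x + INR n + 1) by ring.
rewrite (Rplus_comm 1 (INR n)); ring.
Qed.

(** Writing [ln x] as a telescoping series cancels the increments [ln (n + 2) - ln (n + 1)]. Each
    remaining term compares [/ z] with the integral of [/ t] over [[z, z + 1]], which allows
    termwise bounds. *)
Lemma is_series_ln_sub_digamma (x : R) : 0 < x ->
  is_series (fun n => / (x + INR n) - (ln (x + INR n + 1) - ln (x + INR n)))
    (ln x - digamma x).
Proof.
intros Hx.
pose proof (is_series_minus_R _ _ _ _
  (is_series_ln_telescope x 1 Hx Rlt_0_1) (is_series_digamma x Hx)) as H.
rewrite ln_1 in H.
rewrite Rminus_0_r in H.
revert H; apply is_series_ext_R; intros n; unfold dg_term.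
replace (1 + INR n + 1) with (INR n + 2) by ring.
rewrite (Rplus_comm 1 (INR n)); ring.
Qed.

(** * The gamma integral *)

(** Turns claims about the improper integral into claims about intervals with a small positive left
    end and a large right end. *)
Lemma filter_prod_lt_pos (b0 a0 : R) : 0 < a0 ->
  filter_prod (at_right 0) (Rbar_locally p_infty)
    (fun ab => 0 < fst ab < a0 /\ b0 < snd ab).
Proof.
intros Ha; apply (Filter_prod _ _ _ (fun a => 0 < a < a0) (fun b => b0 < b)).
- exists (mkposreal _ Ha); intros y Hy Hy0; split; trivial.
  apply Rabs_def2 in Hy; unfold minus, plus, opp in Hy; simpl in Hy; lra.
- now exists b0.
- intros a b H1 H2; now split.
Qed.

(** The limit is the supremum of the proper integrals: for a nonnegative integrand these grow with
    the interval, so every interval containing a nearly optimal one is nearly optimal. *)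
Lemma is_RInt_gen_nonneg (f : R -> R) (M : R) :
  (forall t, 0 < t -> continuous f t) -> (forall t, 0 < t -> 0 <= f t) ->
  (forall a b, 0 < a -> a <= b -> RInt f a b <= M) ->
  exists l, is_RInt_gen f (at_right 0) (Rbar_locally p_infty) l /\
    forall a b, 0 < a -> a <= b -> RInt f a b <= l.
Proof.
intros Hc Hf HM.
assert (Hex : forall a b, 0 < a -> a <= b -> ex_RInt f a b).
{ intros a b Ha Hab; apply (ex_RInt_continuous (V := R_CompleteNormedModule)).
  intros z Hz; apply Hc; rewrite Rmin_left in Hz; lra. }
destruct (completeness (fun v => exists a b, 0 < a /\ a <= b /\ v = RInt f a b))
  as [l [Hub Hlub]].
{ exists M; intros v (a & b & Ha & Hab & ->); now apply HM. }
{ exists (RInt f 1 1), 1, 1; repeat split; lra. }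
assert (Hl : forall a b, 0 < a -> a <= b -> RInt f a b <= l).
{ intros a b Ha Hab; apply Hub; now exists a, b. }
exists l; split; trivial.
intros P [eps HP].
assert (Hnear : exists a0 b0, 0 < a0 /\ a0 <= b0 /\ l - eps < RInt f a0 b0).
{ destruct (Classical_Prop.classic
    (exists a0 b0, 0 < a0 /\ a0 <= b0 /\ l - eps < RInt f a0 b0)) as [H|H]; trivial.
  exfalso; pose proof (cond_pos eps).
  assert (l <= l - eps); [|lra].
  apply Hlub; intros v (a & b & Ha & Hab & ->).
  apply Rnot_lt_le; intros Hlt; apply H; now exists a, b. }
destruct Hnear as (a0 & b0 & Ha0 & Hab0 & Hlt).
apply filter_imp with (2 := filter_prod_lt_pos b0 a0 Ha0).
intros [a b]; simpl; intros [[Ha Haa] Hb].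
exists (RInt f a b); split; [apply (RInt_correct (V := R_CompleteNormedModule)), Hex; lra|].
apply HP, Rabs_def1; unfold minus, plus, opp; simpl.
- pose proof (cond_pos eps); specialize (Hl a b); lra.
- assert (RInt f a0 b0 <= RInt f a b); [|lra].
  rewrite <- (RInt_Chasles f a a0 b), <- (RInt_Chasles f a0 b0 b)
    by (apply Hex; lra).
  assert (0 <= RInt f a a0).
  { apply RInt_ge_0; [lra|apply Hex; lra|intros; apply Hf; lra]. }
  assert (0 <= RInt f b0 b).
  { apply RInt_ge_0; [lra|apply Hex; lra|intros; apply Hf; lra]. }
  unfold plus; simpl; lra.
Qed.

Lemma is_RInt_gen_le (f g : R -> R) (lf lg : R) :
  (forall t, 0 < t -> 0 <= f t <= g t) ->
  is_RInt_gen f (at_right 0) (Rbar_locally p_infty) lf ->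
  is_RInt_gen g (at_right 0) (Rbar_locally p_infty) lg -> lf <= lg.
Proof.
intros Hfg Hf Hg.
apply Rle_trans with (norm lf); [apply Rle_abs|].
apply (RInt_gen_norm (Fa := at_right 0) (Fb := Rbar_locally p_infty) f g);
  trivial; apply filter_imp with (2 := filter_prod_lt_pos 1 1 Rlt_0_1);
  intros [a b]; simpl; intros H.
- lra.
- intros t Ht; unfold norm; simpl; unfold abs; simpl.
  assert (0 <= f t <= g t) by (apply Hfg; lra).
  rewrite Rabs_pos_eq; lra.
Qed.

Definition gamma_integrand (x t : R) : R := Rpower t (x - 1) * exp (- t).

Lemma gamma_integrand_exp (x t : R) :
  gamma_integrand x t = exp ((x - 1) * ln t - t).
Proof. unfold gamma_integrand, Rpower; rewrite <- exp_plus; f_equal. Qed.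

Lemma gamma_integrand_continuous (x t : R) :
  0 < t -> continuous (gamma_integrand x) t.
Proof.
intros Ht.
apply (continuous_ext (fun u => exp ((x - 1) * ln u - u))).
- intros u; symmetry; apply gamma_integrand_exp.
- apply (ex_derive_continuous (V := R_NormedModule)); auto_derive; lra.
Qed.

Lemma exp_le_exp (u v : R) : u <= v -> exp u <= exp v.
Proof.
intros [H| ->]; [now apply Rlt_le, exp_increasing|lra].
Qed.

(** The tangent line of the concave [ln] at [c]; a suitable [c] lets [exp (- t)] absorb any power of
    [t]. *)
Lemma ln_le_tangent (c y : R) : 0 < c -> 0 < y -> ln y <= y / c - 1 + ln c.
Proof.
intros Hc Hy.
generalize (exp_ineq1_le (ln y - ln c)).
unfold Rminus; rewrite exp_plus, exp_Ropp, !exp_ln by trivial; unfold Rdiv; lra.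
Qed.

(* [t^x / (1+t)^x] is a bounded function whose derivative
   [x t^(x-1) / (1+t)^(x+1)] dominates a multiple of the integrand. *)
Lemma gamma_integrand_RInt_bound (x : R) : 0 < x ->
  exists M, forall a b, 0 < a -> a <= b -> RInt (gamma_integrand x) a b <= M.
Proof.
intros Hx.
(* The exponential is the maximum of [(1 + t)^(x+1) exp(-t)], attained at [t = x]; dividing by [x]
   cancels the factor produced by differentiating [H]. *)
set (K := exp ((x + 1) * ln (x + 1) - x) / x).
assert (HK : 0 < K) by (apply Rdiv_lt_0_compat; [apply exp_pos|lra]).
set (H := fun t => K * exp (x * (ln t - ln (1 + t)))).
set (dH := fun t => K * x * exp ((x - 1) * ln t - (x + 1) * ln (1 + t))).
assert (HdH : forall t, 0 < t -> is_derive H t (dH t)).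
{ intros t Ht; unfold H, dH; auto_derive; [lra|].
  replace ((x - 1) * ln t - (x + 1) * ln (1 + t)) with
    (x * (ln t - ln (1 + t)) + - ln t + - ln (1 + t)) by ring.
  rewrite !exp_plus, !exp_Ropp, !exp_ln by lra.
  unfold Rminus; field; lra. }
assert (HH : forall t, 0 < t -> 0 <= H t <= K).
{ intros t Ht; unfold H.
  assert (ln t <= ln (1 + t)) by (apply ln_le; lra).
  assert (exp (x * (ln t - ln (1 + t))) <= exp 0) by (apply exp_le_exp; nra).
  rewrite exp_0 in *.
  pose proof (exp_pos (x * (ln t - ln (1 + t)))); nra. }
assert (Hle : forall t, 0 < t -> gamma_integrand x t <= dH t).
{ intros t Ht; rewrite gamma_integrand_exp; unfold dH, K.
  replace (exp ((x + 1) * ln (x + 1) - x) / x * x) with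
    (exp ((x + 1) * ln (x + 1) - x)) by (field; lra).
  rewrite <- exp_plus; apply exp_le_exp.
  pose proof (ln_le_tangent (x + 1) (1 + t) ltac:(lra) ltac:(lra)) as Hln.
  apply (Rmult_le_compat_l (x + 1)) in Hln; [|lra].
  replace ((x + 1) * ((1 + t) / (x + 1) - 1 + ln (x + 1))) with
    (1 + t - (x + 1) + (x + 1) * ln (x + 1)) in Hln by (field; lra).
  lra. }
exists K; intros a b Ha Hab.
assert (Hm : forall t, Rmin a b <= t <= Rmax a b -> 0 < t).
{ intros t; rewrite Rmin_left; lra. }
apply Rle_trans with (minus (H b) (H a)).
2: { pose proof (HH a Ha); pose proof (HH b ltac:(lra)).
     unfold minus, plus, opp; simpl; lra. }
apply (is_RInt_le (gamma_integrand x) dH a b); trivial.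
- apply (RInt_correct (V := R_CompleteNormedModule)),
    (ex_RInt_continuous (V := R_CompleteNormedModule)).
  intros t Ht; apply gamma_integrand_continuous; auto.
- apply (is_RInt_derive (V := R_CompleteNormedModule)).
  + intros t Ht; apply HdH; auto.
  + intros t Ht; apply (ex_derive_continuous (V := R_NormedModule)).
    specialize (Hm t Ht); unfold dH; auto_derive; lra.
- intros t Ht; apply Hle; lra.
Qed.

Lemma gamma_integrand_pos (x t : R) : 0 < gamma_integrand x t.
Proof. rewrite gamma_integrand_exp; apply exp_pos. Qed.

Lemma Gamma_spec (x : R) : 0 < x ->
  is_RInt_gen (gamma_integrand x) (at_right 0) (Rbar_locally p_infty) (Gamma x)
  /\ 0 < Gamma x.
Proof.
intros Hx.
destruct (gamma_integrand_RInt_bound x Hx) as [M HM].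
destruct (is_RInt_gen_nonneg (gamma_integrand x) M) as [l [Hl Hle]]; trivial.
{ intros; now apply gamma_integrand_continuous. }
{ intros; apply Rlt_le, gamma_integrand_pos. }
assert (E : Gamma x = l).
{ apply (is_RInt_gen_unique (gamma_integrand x) l Hl). }
rewrite E; split; trivial.
(* Positivity already follows from the proper integral over [[1, 2]]. *)
apply Rlt_le_trans with (2 := Hle 1 2 ltac:(lra) ltac:(lra)).
apply RInt_gt_0; [lra|intros; apply gamma_integrand_pos|].
intros t Ht; apply gamma_integrand_continuous; lra.
Qed.

Lemma filterlim_pow_exp_0 (x : R) : 0 < x ->
  filterlim (fun t => exp (x * ln t - t)) (at_right 0) (locally 0).
Proof.
intros Hx; apply filterlim_locally; intros eps.
(* The radius is [eps^(1/x)]: below it [t^x < eps], while [exp (- t) <= 1]. *)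
pose proof (exp_pos (ln eps / x)) as Hd.
exists (mkposreal _ Hd); intros t Ht Ht0.
apply Rabs_def2 in Ht; unfold minus, plus, opp in Ht; simpl in Ht.
apply Rabs_def1; unfold minus, plus, opp; simpl.
2: { pose proof (exp_pos (x * ln t - t)); pose proof (cond_pos eps); lra. }
assert (exp (x * ln t - t) < eps); [|lra].
rewrite <- (exp_ln eps) by apply cond_pos; apply exp_increasing.
assert (ln t < ln eps / x).
{ rewrite <- (ln_exp (ln eps / x)); apply ln_increasing; lra. }
assert (x * ln t < ln eps); [|lra].
replace (ln eps) with (x * (ln eps / x)) by (field; lra).
now apply Rmult_lt_compat_l.
Qed.

Lemma filterlim_pow_exp_infty (x : R) : 0 < x ->
  filterlim (fun t => exp (x * ln t - t)) (Rbar_locally p_infty) (locally 0).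
Proof.
intros Hx; apply filterlim_locally; intros eps.
(* The tangent of [ln] at [2 * x] gives [x * ln t <= t / 2 + C], so the exponent is at most
   [C - t / 2]. *)
set (C := x * (ln (2 * x) - 1)).
exists (Rmax 0 (2 * (C - ln eps))); intros t Ht.
pose proof (Rmax_l 0 (2 * (C - ln eps))).
pose proof (Rmax_r 0 (2 * (C - ln eps))).
apply Rabs_def1; unfold minus, plus, opp; simpl.
2: { pose proof (exp_pos (x * ln t - t)); pose proof (cond_pos eps); lra. }
assert (exp (x * ln t - t) < eps); [|lra].
rewrite <- (exp_ln eps) by apply cond_pos; apply exp_increasing.
pose proof (ln_le_tangent (2 * x) t ltac:(lra) ltac:(lra)) as Hln.
apply (Rmult_le_compat_l x) in Hln; [|lra].
replace (x * (t / (2 * x) - 1 + ln (2 * x))) with (t / 2 + C) in Hln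
  by (unfold C; field; lra).
lra.
Qed.

(** Integration by parts: the derivative of [t^x exp(-t)] is [x] times one integrand minus the
    other, and its improper integral is zero because both boundary values vanish. *)
Lemma Gamma_succ (x : R) : 0 < x -> Gamma (x + 1) = x * Gamma x.
Proof.
intros Hx.
destruct (Gamma_spec x Hx) as [H1 _].
destruct (Gamma_spec (x + 1) ltac:(lra)) as [H2 _].
set (f := fun t => exp (x * ln t - t)).
assert (Hf : forall t, 0 < t -> is_derive f t
  (minus (scal x (gamma_integrand x t)) (gamma_integrand (x + 1) t))).
{ intros t Ht; unfold f; rewrite !gamma_integrand_exp; auto_derive; [lra|].
  unfold minus, plus, opp, scal; simpl; unfold mult; simpl.
  replace ((x - 1) * ln t - t) with ((x * ln t - t) + - ln t) by ring.
  replace ((x + 1 - 1) * ln t - t) with (x * ln t - t) by ring.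
  rewrite (exp_plus _ (- ln t)), exp_Ropp, exp_ln by trivial.
  unfold Rminus; field; lra. }
pose proof (is_RInt_gen_minus _ _ _ _ (is_RInt_gen_scal _ x _ H1) H2) as H3.
assert (H4 : is_RInt_gen (Derive f) (at_right 0) (Rbar_locally p_infty) (0 - 0)).
{ assert (Hmin : forall a b t, 0 < a -> 1 < b -> Rmin a b <= t -> 0 < t).
  { intros a b t Ha Hb; unfold Rmin; destruct (Rle_dec a b); lra. }
  apply is_RInt_gen_Derive.
  - apply filter_imp with (2 := filter_prod_lt_pos 1 1 Rlt_0_1).
    intros [a b]; simpl; intros H t Ht.
    eexists; apply Hf, (Hmin a b); lra.
  - apply filter_imp with (2 := filter_prod_lt_pos 1 1 Rlt_0_1).
    intros [a b]; simpl; intros H t Ht.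
    assert (Ht0 : 0 < t) by (apply (Hmin a b); lra).
    apply (continuous_ext_loc _ (fun u =>
      minus (scal x (gamma_integrand x u)) (gamma_integrand (x + 1) u))).
    + exists (mkposreal _ Ht0); intros u Hu.
      symmetry; apply is_derive_unique, Hf.
      apply Rabs_def2 in Hu; unfold minus, plus, opp in Hu; simpl in Hu; lra.
    + apply (continuous_minus (V := R_NormedModule));
        [apply (continuous_scal_r (V := R_NormedModule))|];
        now apply gamma_integrand_continuous.
  - now apply filterlim_pow_exp_0.
  - now apply filterlim_pow_exp_infty. }
assert (H5 : is_RInt_gen (fun t => minus (scal x (gamma_integrand x t))
  (gamma_integrand (x + 1) t)) (at_right 0) (Rbar_locally p_infty) (0 - 0)).
{ apply is_RInt_gen_ext with (2 := H4).
  apply filter_imp with (2 := filter_prod_lt_pos 1 1 Rlt_0_1).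
  intros [a b]; simpl; intros H t Ht; apply is_derive_unique, Hf.
  rewrite Rmin_left in Ht; lra. }
apply (is_RInt_gen_unique (V := R_CompleteNormedModule)) in H3.
apply (is_RInt_gen_unique (V := R_CompleteNormedModule)) in H5.
pose proof (eq_trans (eq_sym H5) H3) as H6.
change (0 - 0 = x * Gamma x - Gamma (x + 1)) in H6; lra.
Qed.

(** * Wendel's inequality and increments of the logarithm of Gamma *)

Lemma exp_convex (s r : R) : 0 <= s <= 1 -> exp (s * r) <= 1 - s + s * exp r.
Proof.
intros Hs.
pose proof (exp_pos (s * r)) as He.
pose proof (exp_ineq1_le (- (s * r))) as H1.
pose proof (exp_ineq1_le ((1 - s) * r)) as H2.
assert (E1 : exp (s * r) * exp (- (s * r)) = 1).
{ rewrite <- exp_plus, Rplus_opp_r; apply exp_0. }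
assert (E2 : exp (s * r) * exp ((1 - s) * r) = exp r).
{ rewrite <- exp_plus; f_equal; ring. }
(* The tangent bounds [H1] and [H2], weighted by [1 - s] and [s], have cancelling linear terms and
   add up to [1]; multiplying by [exp (s * r)] gives the claim. *)
rewrite <- E2.
replace (1 - s + _) with ((1 - s) * (exp (s * r) * exp (- (s * r)))
  + s * (exp (s * r) * exp ((1 - s) * r))) by (rewrite E1; ring).
assert (0 <= (1 - s) * (exp (- (s * r)) - (1 + - (s * r)))) by (apply Rmult_le_pos; lra).
assert (0 <= s * (exp ((1 - s) * r) - (1 + (1 - s) * r))) by (apply Rmult_le_pos; lra).
nra.
Qed.

(* Wendel: integrate [t^s <= y^s ((1 - s) + s t / y)] against
   [t^(y-1) exp(-t)]. *)
Lemma Gamma_add_le (y s : R) :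
  0 < y -> 0 <= s <= 1 -> Gamma (y + s) <= exp (s * ln y) * Gamma y.
Proof.
intros Hy Hs.
destruct (Gamma_spec y Hy) as [H0 _].
destruct (Gamma_spec (y + 1) ltac:(lra)) as [H1 _].
destruct (Gamma_spec (y + s) ltac:(lra)) as [H2 _].
pose proof (is_RInt_gen_plus _ _ _ _
  (is_RInt_gen_scal _ (exp (s * ln y) * (1 - s)) _ H0)
  (is_RInt_gen_scal _ (exp (s * ln y) * (s / y)) _ H1)) as H3.
replace (exp (s * ln y) * Gamma y) with
  (plus (scal (exp (s * ln y) * (1 - s)) (Gamma y))
        (scal (exp (s * ln y) * (s / y)) (Gamma (y + 1)))).
2: { rewrite Gamma_succ by trivial; unfold plus, scal; simpl; unfold mult; simpl.
     field; lra. }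
apply is_RInt_gen_le with (2 := H2) (3 := H3).
intros t Ht; split; [apply Rlt_le, gamma_integrand_pos|].
rewrite !gamma_integrand_exp; unfold plus, scal; simpl; unfold mult; simpl.
replace ((y + s - 1) * ln t - t) with
  (s * ln y + ((y - 1) * ln t - t) + s * (ln t - ln y)) by ring.
replace ((y + 1 - 1) * ln t - t) with (((y - 1) * ln t - t) + ln t) by ring.
rewrite !exp_plus, exp_ln by trivial.
generalize (exp_convex s (ln t - ln y) Hs).
unfold Rminus at 3; rewrite exp_plus, exp_Ropp, !exp_ln by trivial; intros Hc.
pose proof (Rmult_lt_0_compat _ _ (exp_pos (s * ln y))
  (exp_pos ((y - 1) * ln t - t))) as Hp.
apply (Rmult_le_compat_l _ _ _ (Rlt_le _ _ Hp)) in Hc.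
eapply Rle_trans; [exact Hc|apply Req_le; field; lra].
Qed.

Lemma ln_Gamma_succ (y : R) : 0 < y -> ln (Gamma (y + 1)) = ln (Gamma y) + ln y.
Proof.
intros Hy; destruct (Gamma_spec y Hy) as [_ Hp].
rewrite Gamma_succ, ln_mult by trivial; ring.
Qed.

Lemma ln_Gamma_add_le (y s : R) :
  0 < y -> 0 <= s <= 1 -> ln (Gamma (y + s)) <= ln (Gamma y) + s * ln y.
Proof.
intros Hy Hs.
destruct (Gamma_spec y Hy) as [_ Hp].
destruct (Gamma_spec (y + s) ltac:(lra)) as [_ Hp'].
rewrite <- (ln_exp (s * ln y)), (Rplus_comm (ln _)), <- ln_mult
  by (trivial; apply exp_pos).
apply ln_le; trivial; now apply Gamma_add_le.
Qed.

(** The upper bound applied from [y + s] with the complementary step [1 - s], which lands on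
    [y + 1]. *)
Lemma ln_Gamma_add_ge (y s : R) : 0 < y -> 0 <= s <= 1 ->
  ln (Gamma y) + ln y - (1 - s) * ln (y + s) <= ln (Gamma (y + s)).
Proof.
intros Hy Hs.
generalize (ln_Gamma_add_le (y + s) (1 - s) ltac:(lra) ltac:(lra)).
replace (y + s + (1 - s)) with (y + 1) by ring.
rewrite ln_Gamma_succ by trivial; lra.
Qed.

(** * Bounds for the digamma and zeta series *)

Lemma digamma_succ (x : R) : 0 < x -> digamma (x + 1) = digamma x + / x.
Proof.
intros Hx; apply is_series_unique.
pose proof (is_series_plus_R _ _ _ _ (is_series_digamma x Hx)
  (is_series_telescope_inv_pow x 0 Hx)) as H.
replace (digamma x + / x) with (digamma x + / x ^ 1) by (f_equal; f_equal; ring).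
revert H; apply is_series_ext_R; intros n; pose proof (shift_pos x n Hx).
unfold dg_term; rewrite !pow_1.
replace (x + 1 + INR n) with (x + INR n + 1) by ring.
field; lra.
Qed.

Lemma zeta_succ (m : nat) (x : R) :
  0 < x -> zeta (S (S m)) (x + 1) = zeta (S (S m)) x - / x ^ S (S m).
Proof.
intros Hx; apply is_series_unique.
pose proof (is_series_minus_R _ _ _ _ (is_series_zeta m x Hx)
  (is_series_telescope_inv_pow x (S m) Hx)) as H.
revert H; apply is_series_ext_R; intros n.
replace (x + 1 + INR n) with (x + INR n + 1) by ring.
ring.
Qed.

(** * Tangent, trapezoid and midpoint inequalities for convex functions *)

Lemma bernoulli_le (r : R) (m : nat) : 0 <= r -> 1 + INR m * (r - 1) <= r ^ m.
Proof.
intros Hr; induction m as [|m IH]; [simpl; lra|].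
rewrite S_INR; simpl pow; pose proof (pos_INR m).
apply Rle_trans with (r * (1 + INR m * (r - 1))).
- assert (0 <= INR m * (r - 1) ^ 2); [apply Rmult_le_pos; [lra|apply pow2_ge_0]|].
  nra.
- now apply Rmult_le_compat_l.
Qed.

(** After multiplication by [u ^ m] this is Bernoulli's inequality for [(u / v) ^ m], weakened by
    [1 - v / u <= u / v - 1]. *)
Lemma inv_pow_tangent (m : nat) (u v : R) : 0 < u -> 0 < v ->
  / u ^ m + (- INR m * / u ^ S m) * (v - u) <= / v ^ m.
Proof.
intros Hu Hv; pose proof (pos_INR m) as Hm.
assert (Hum : 0 < u ^ m) by now apply pow_lt.
assert (Hvm : 0 < v ^ m) by now apply pow_lt.
assert (Hr : 0 <= u / v) by now apply Rlt_le, Rdiv_lt_0_compat.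
generalize (bernoulli_le (u / v) m Hr).
unfold Rdiv; rewrite Rpow_mult_distr, pow_inv; intros Hb.
assert (H1 : 1 - v / u <= u / v - 1).
{ assert (0 <= (u - v) ^ 2 / (u * v)).
  { apply Rmult_le_pos; [apply pow2_ge_0|].
    apply Rlt_le, Rinv_0_lt_compat; nra. }
  replace ((u - v) ^ 2 / (u * v)) with (u / v - 1 - (1 - v / u)) in H
    by (field; lra).
  lra. }
apply (Rmult_le_reg_l (u ^ m)); trivial.
replace (u ^ m * (/ u ^ m + - INR m * / u ^ S m * (v - u))) with
  (1 + INR m * (1 - v / u)) by (simpl; field; lra).
apply Rle_trans with (2 := Hb).
unfold Rdiv in H1 |- *; nra.
Qed.

(** The trapezoid error, as a function of the right endpoint [v], has as derivative half the gap at
    [a] between [f] and its tangent at [v]; hence it is nondecreasing for [v >= a]. *)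
Lemma trapezoid_le (F f df : R -> R)
  (HF : forall z, 0 < z -> is_derive F z (f z))
  (Hf : forall z, 0 < z -> is_derive f z (df z))
  (Htangent : forall u v, 0 < u -> 0 < v -> f u + df u * (v - u) <= f v)
  (a b : R) :
  0 < a -> a <= b -> F b - F a <= (b - a) * ((f a + f b) / 2).
Proof.
intros Ha Hab.
destruct (MVT_pos (fun v => (v - a) * ((f a + f v) / 2) - F v)
  (fun v => (f a - (f v + df v * (a - v))) / 2) a b) as [c [Hc E]]; try lra.
- intros z Hz.
  pose proof (HF z Hz) as H1; pose proof (Hf z Hz) as H2.
  auto_derive; [repeat split; [now exists (df z)|now exists (f z)]|].
  replace (Derive (fun t => f t) z) with (df z)
    by (symmetry; now apply is_derive_unique).
  replace (Derive (fun t => F t) z) with (f z)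
    by (symmetry; now apply is_derive_unique).
  field.
- assert (0 < c) by (rewrite Rmin_left in Hc; lra).
  pose proof (Htangent c a H Ha).
  assert (0 <= (f a - (f c + df c * (a - c))) / 2 * (b - a)).
  { apply Rmult_le_pos; lra. }
  lra.
Qed.

(** [F] minus the integral of the tangent at the midpoint is nondecreasing; the quadratic part of
    that integral agrees at [a] and [b] by symmetry and drops out. *)
Lemma midpoint_le (F f df : R -> R)
  (HF : forall z, 0 < z -> is_derive F z (f z))
  (Htangent : forall u v, 0 < u -> 0 < v -> f u + df u * (v - u) <= f v)
  (a b : R) :
  0 < a -> a <= b -> (b - a) * f ((a + b) / 2) <= F b - F a.
Proof.
intros Ha Hab; set (m := (a + b) / 2).
assert (Hm : 0 < m) by (unfold m; lra).
destruct (MVT_pos (fun v => F v - (f m * (v - m) + df m * (v - m) ^ 2 / 2))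
  (fun v => f v - (f m + df m * (v - m))) a b) as [c [Hc E]]; try lra.
- intros z Hz; pose proof (HF z Hz) as H1.
  auto_derive; [now exists (f z)|].
  replace (Derive (fun t => F t) z) with (f z)
    by (symmetry; now apply is_derive_unique).
  field.
- assert (0 < c) by (rewrite Rmin_left in Hc; lra).
  pose proof (Htangent m c Hm H).
  assert (0 <= (f c - (f m + df m * (c - m))) * (b - a)).
  { apply Rmult_le_pos; lra. }
  replace ((a - m) ^ 2) with ((b - m) ^ 2) in E by (unfold m; field).
  replace ((b - a) * f m) with (f m * (b - m) - f m * (a - m)) by ring.
  lra.
Qed.

Lemma is_derive_inv_pow_0 (m : nat) (y : R) :
  0 < y -> is_derive (fun t => / t ^ m) y (- INR m * / y ^ S m).
Proof.
intros Hy.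
pose proof (is_derive_inv_pow m 0 y ltac:(lra)) as H.
rewrite Rplus_0_r in H; revert H.
apply is_derive_ext; intros t; now rewrite Rplus_0_r.
Qed.

Lemma ln_trapezoid_midpoint (z : R) : 0 < z ->
  / (z + 1 / 2) <= ln (z + 1) - ln z <= (/ z + / (z + 1)) / 2.
Proof.
intros Hz; assert (Hzz : z <= z + 1) by lra.
assert (H1 : forall z, 0 < z -> is_derive ln z (/ z ^ 1)).
{ intros y Hy; rewrite pow_1; now apply is_derive_ln. }
pose proof (midpoint_le ln _ _ H1 (inv_pow_tangent 1) z (z + 1) Hz Hzz) as Hmid.
pose proof (trapezoid_le ln _ _ H1 (is_derive_inv_pow_0 1) (inv_pow_tangent 1)
  z (z + 1) Hz Hzz) as Htrap.
cbv beta in Hmid, Htrap.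
rewrite pow_1 in Hmid; rewrite (pow_1 z), (pow_1 (z + 1)) in Htrap.
replace ((z + (z + 1)) / 2) with (z + 1 / 2) in Hmid by field.
lra.
Qed.

Lemma inv_pow_trapezoid_midpoint (m : nat) (z : R) : 0 < z ->
  INR (S m) * / (z + 1 / 2) ^ S (S m)
    <= / z ^ S m - / (z + 1) ^ S m
    <= INR (S m) * ((/ z ^ S (S m) + / (z + 1) ^ S (S m)) / 2).
Proof.
intros Hz; assert (Hzz : z <= z + 1) by lra.
assert (Hm : 0 < INR (S m)) by (apply lt_0_INR; lia).
(* An antiderivative of [t^(-(m+2))]. *)
set (F := fun t => - / INR (S m) * / t ^ S m).
assert (H1 : forall z, 0 < z -> is_derive F z (/ z ^ S (S m))).
{ intros y Hy; unfold F.
  replace (/ y ^ S (S m)) with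
    (- / INR (S m) * (- INR (S m) * / y ^ S (S m)))
    by (field; split; [apply pow_nonzero|]; lra).
  now apply is_derive_scal, is_derive_inv_pow_0. }
pose proof (midpoint_le F _ _ H1 (inv_pow_tangent _) z (z + 1) Hz Hzz) as Hmid.
pose proof (trapezoid_le F _ _ H1 (is_derive_inv_pow_0 _) (inv_pow_tangent _)
  z (z + 1) Hz Hzz) as Htrap.
cbv beta in Hmid, Htrap.
replace ((z + (z + 1)) / 2) with (z + 1 / 2) in Hmid by field.
replace (z + 1 - z) with 1 in * by ring.
assert (E : / z ^ S m - / (z + 1) ^ S m = INR (S m) * (F (z + 1) - F z)).
{ unfold F; field; repeat split; try apply pow_nonzero; lra. }
rewrite E; split; apply Rmult_le_compat_l; lra.
Qed.

(** * Estimates of the digamma and zeta series by termwise comparison *)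

Lemma digamma_bounds (x : R) :
  0 < x -> ln x - 1 / x <= digamma x <= ln x - 1 / (2 * x).
Proof.
intros Hx.
pose proof (is_series_ln_sub_digamma x Hx) as H.
pose proof (is_series_telescope_inv_pow x 0 Hx) as HT; rewrite pow_1 in HT.
(* With [z = x + INR n], each term lies between half and the whole of [/ z - / (z + 1)]: the tangent
   bound gives the whole, the trapezoid bound the half. *)
assert (ln x - digamma x <= / x).
{ apply (is_series_le _ _ _ _ H HT); intros n; rewrite !pow_1.
  pose proof (shift_pos x n Hx) as Hn; set (z := x + INR n) in *.
  pose proof (ln_sub_bounds z (z + 1) Hn ltac:(lra)) as [Hl _].
  replace ((z + 1 - z) / (z + 1)) with (/ (z + 1)) in Hl by (field; lra).
  lra. }
assert (/ x * / 2 <= ln x - digamma x).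
{ apply (is_series_le _ _ _ _ (is_series_scal_r (/ 2) _ _ HT) H).
  intros n; rewrite !pow_1.
  pose proof (ln_trapezoid_midpoint _ (shift_pos x n Hx)); lra. }
replace (1 / x) with (/ x) by (field; lra).
replace (1 / (2 * x)) with (/ x * / 2) by (field; lra).
lra.
Qed.

(** Once [ln x] is a series, the claim is termwise the midpoint inequality: [ln (z + 1) - ln z] is
    at least [/ (z + 1 / 2)], hence at least [/ (z + beta)]. *)
Lemma digamma_half_ge (x beta : R) :
  0 < x -> 1 / 2 <= beta -> ln x <= digamma (x + beta).
Proof.
intros Hx Hb.
pose proof (is_series_plus_R _ _ _ _
  (is_series_ln_sub_digamma x Hx) (is_series_digamma x Hx)) as H.
replace (ln x - digamma x + digamma x) with (ln x) in H by ring.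
apply (is_series_le _ _ _ _ H (is_series_digamma (x + beta) ltac:(lra))).
intros n; unfold dg_term.
pose proof (ln_trapezoid_midpoint _ (shift_pos x n Hx)).
assert (/ (x + beta + INR n) <= / (x + INR n + 1 / 2)).
{ pose proof (shift_pos x n Hx); apply Rinv_le_contravar; lra. }
lra.
Qed.

(** The tangent inequality for [/ t] at each [x + INR n], summed. *)
Lemma digamma_add_le (x d : R) : 0 < x -> 0 <= d ->
  digamma (x + d) <= digamma x + d * zeta 2 x.
Proof.
intros Hx Hd.
pose proof (is_series_plus_R _ _ _ _ (is_series_digamma x Hx)
  (is_series_scal_l_R d _ _ (is_series_zeta 0 x Hx))) as H.
apply (is_series_le _ _ _ _ (is_series_digamma (x + d) ltac:(lra)) H).
intros n; unfold dg_term.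
pose proof (inv_pow_tangent 1 (x + INR n) (x + d + INR n)
  (shift_pos x n Hx) ltac:(apply shift_pos; lra)) as Ht.
rewrite !pow_1 in Ht; simpl INR in Ht.
replace (x + d + INR n - (x + INR n)) with d in Ht by ring; lra.
Qed.

(** Two telescoping series bound the terms: the lower bound rearranges the trapezoid inequality on
    [[z, z + 1]], the upper one is the tangent at [z + 1] evaluated at [z]. *)
Lemma zeta_bounds (m : nat) (x : R) : 0 < x ->
  / x ^ S m + INR (S m) * (/ x ^ S (S m) * / 2)
    <= INR (S m) * zeta (S (S m)) x
    <= / x ^ S m + INR (S m) * / x ^ S (S m).
Proof.
intros Hx.
pose proof (is_series_scal_l_R (INR (S m)) _ _
  (is_series_zeta m x Hx)) as H.
pose proof (is_series_telescope_inv_pow x m Hx) as H0.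
pose proof (is_series_telescope_inv_pow x (S m) Hx) as H1.
split.
- apply (is_series_le _ _ _ _ (is_series_plus_R _ _ _ _ H0
    (is_series_scal_l_R (INR (S m)) _ _
      (is_series_scal_r (/ 2) _ _ H1))) H).
  intros n.
  pose proof (inv_pow_trapezoid_midpoint m _ (shift_pos x n Hx)); lra.
- apply (is_series_le _ _ _ _ H (is_series_plus_R _ _ _ _ H0
    (is_series_scal_l_R (INR (S m)) _ _ H1))).
  intros n.
  pose proof (shift_pos x n Hx).
  pose proof (inv_pow_tangent (S m) (x + INR n + 1) (x + INR n)
    ltac:(lra) ltac:(lra)) as Ht.
  replace (x + INR n - (x + INR n + 1)) with (-1) in Ht by ring; lra.
Qed.

Lemma zeta_half_le (m : nat) (x beta : R) : 0 < x -> 1 / 2 <= beta ->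
  INR (S m) * zeta (S (S m)) (x + beta) <= / x ^ S m.
Proof.
intros Hx Hb.
pose proof (is_series_scal_l_R (INR (S m)) _ _
  (is_series_zeta m (x + beta) ltac:(lra))) as H.
apply (is_series_le _ _ _ _ H (is_series_telescope_inv_pow x m Hx)).
intros n.
pose proof (shift_pos x n Hx).
apply Rle_trans with (INR (S m) * / (x + INR n + 1 / 2) ^ S (S m)).
- apply Rmult_le_compat_l; [apply pos_INR|apply inv_pow_le; lra].
- now apply inv_pow_trapezoid_midpoint.
Qed.

Lemma zeta_add_ge (m : nat) (x d : R) : 0 < x -> 0 <= d ->
  zeta (S (S m)) x - d * (INR (S (S m)) * zeta (S (S (S m))) x)
    <= zeta (S (S m)) (x + d).
Proof.
intros Hx Hd.
pose proof (is_series_minus_R _ _ _ _ (is_series_zeta m x Hx)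
  (is_series_scal_l_R d _ _
    (is_series_scal_l_R (INR (S (S m))) _ _
      (is_series_zeta (S m) x Hx)))) as H.
apply (is_series_le _ _ _ _ H (is_series_zeta m (x + d) ltac:(lra))).
intros n.
pose proof (inv_pow_tangent (S (S m)) (x + INR n) (x + d + INR n)
  (shift_pos x n Hx) ltac:(apply shift_pos; lra)) as Ht.
replace (x + d + INR n - (x + INR n)) with d in Ht by ring; lra.
Qed.

(** * Identification of psi and its derivatives *)

(** The increment is [s * digamma c] with [y <= c <= y + 1], and the series bounds place [digamma c]
    within [1 / y] of [ln y]. *)
Lemma lgamma_add_bounds (y s : R) : 0 < y -> 0 <= s <= 1 ->
  Rabs (lgamma (y + s) - lgamma y - s * ln y) <= 1 / y.
Proof.
intros Hy Hs.
destruct (MVT_pos lgamma digamma y (y + s)) as [c [Hc E]]; try lra.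
{ intros; now apply is_derive_lgamma. }
rewrite Rmin_left, Rmax_right in Hc by lra.
rewrite E; replace (y + s - y) with s by ring.
pose proof (digamma_bounds c ltac:(lra)) as Bc.
assert (H1 : 1 / c <= 1 / y) by (apply Rmult_le_compat_l; [|apply Rinv_le_contravar]; lra).
assert (H2 : 0 < 1 / (2 * c)) by (apply Rdiv_lt_0_compat; lra).
pose proof (ln_sub_bounds y c Hy ltac:(lra)) as Bl.
assert (H3 : 0 <= (c - y) / c).
{ apply Rmult_le_pos; [|apply Rlt_le, Rinv_0_lt_compat]; lra. }
assert (H4 : (c - y) / y <= 1 / y).
{ apply Rmult_le_compat_r; [apply Rlt_le, Rinv_0_lt_compat|]; lra. }
replace (digamma c * s - s * ln y) with (s * (digamma c - ln y)) by ring.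
rewrite Rabs_mult, (Rabs_pos_eq s) by lra.
apply Rle_trans with (1 * Rabs (digamma c - ln y)).
- apply Rmult_le_compat_r; [apply Rabs_pos|lra].
- rewrite Rmult_1_l; apply Rabs_le; lra.
Qed.

Lemma ln_Gamma_add_bounds (y s : R) : 0 < y -> 0 <= s <= 1 ->
  Rabs (ln (Gamma (y + s)) - ln (Gamma y) - s * ln y) <= 1 / y.
Proof.
intros Hy Hs.
pose proof (ln_Gamma_add_le y s Hy Hs).
pose proof (ln_Gamma_add_ge y s Hy Hs).
pose proof (ln_sub_bounds y (y + s) Hy ltac:(lra)) as [_ Hl].
assert (Hs1 : (y + s - y) / y <= 1 / y).
{ apply Rmult_le_compat_r; [apply Rlt_le, Rinv_0_lt_compat|]; lra. }
assert (H1 : 0 < 1 / y) by (apply Rdiv_lt_0_compat; lra).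
apply Rabs_le; split; [|lra].
assert ((1 - s) * (ln (y + s) - ln y) <= 1 * (1 / y)); [|lra].
apply Rle_trans with ((1 - s) * (1 / y)).
- apply Rmult_le_compat_l; lra.
- apply Rmult_le_compat_r; lra.
Qed.

(* [ln Gamma - lgamma] is 1-periodic, and both functions satisfy
   [g(y+s) - g(y) = s ln y + O(1/y)]. *)
Lemma ln_Gamma_sub_lgamma_const (y s : R) : 0 < y -> 0 <= s <= 1 ->
  ln (Gamma (y + s)) - lgamma (y + s) = ln (Gamma y) - lgamma y.
Proof.
intros Hy Hs.
set (D := fun z => ln (Gamma z) - lgamma z).
assert (Hper : forall n z, 0 < z -> D (z + INR n) = D z).
{ induction n as [|n IH]; intros z Hz; [simpl; now rewrite Rplus_0_r|].
  rewrite S_INR, <- Rplus_assoc, <- (IH z Hz).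
  pose proof (shift_pos z n Hz).
  unfold D; rewrite ln_Gamma_succ, lgamma_succ by trivial; ring. }
(* Periodicity moves both points up by [n], where the two asymptotic bounds each contribute
   [1 / (y + n)]; the left side does not depend on [n]. *)
assert (Hb : forall n, Rabs (D (y + s) - D y) <= 2 * / (y + INR n) ^ 1).
{ intros n; pose proof (shift_pos y n Hy) as Hn.
  rewrite <- (Hper n y), <- (Hper n (y + s)) by lra.
  replace (y + s + INR n) with (y + INR n + s) by ring.
  rewrite pow_1; set (z := y + INR n) in *; unfold D.
  pose proof (lgamma_add_bounds z s Hn Hs) as B1.
  pose proof (ln_Gamma_add_bounds z s Hn Hs) as B2.
  apply Rabs_le_between in B1; apply Rabs_le_between in B2.
  apply Rabs_le; lra. }
assert (H0 : Rabs (D (y + s) - D y) <= 2 * 0).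
{ apply (is_lim_seq_le (fun _ => Rabs (D (y + s) - D y))
    (fun n => 2 * / (y + INR n) ^ 1)
    (Rabs (D (y + s) - D y)) (2 * 0)); trivial.
  - apply is_lim_seq_const.
  - apply is_lim_seq_mult'; [apply is_lim_seq_const|].
    now apply is_lim_seq_inv_shift_pow. }
apply Rabs_le_between in H0; unfold D in H0; lra.
Qed.

(** Near [x], [Gamma] is a constant multiple of [exp] of [lgamma], so its derivative comes from that
    of [lgamma]. *)
Lemma psi_digamma (x : R) : 0 < x -> psi x = digamma x.
Proof.
intros Hx.
destruct (Gamma_spec x Hx) as [_ Hpos].
assert (Hnear : forall z, 0 < z -> Rabs (z - x) < 1 ->
  Gamma z = Gamma x * exp (lgamma z - lgamma x)).
{ intros z Hz Hzx.
  destruct (Gamma_spec z Hz) as [_ Hzpos].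
  assert (E : ln (Gamma z) - lgamma z = ln (Gamma x) - lgamma x).
  (* The constancy lemma only moves to the right, so the smaller of [x] and [z] serves as base
     point. *)
  { apply Rabs_def2 in Hzx; destruct (Rle_dec x z).
    - replace z with (x + (z - x)) by ring.
      apply ln_Gamma_sub_lgamma_const; lra.
    - symmetry; replace x with (z + (x - z)) by ring.
      apply ln_Gamma_sub_lgamma_const; lra. }
  rewrite <- (exp_ln (Gamma z)), <- (exp_ln (Gamma x)) at 1 by trivial.
  rewrite <- exp_plus; f_equal; lra. }
unfold psi.
replace (Derive Gamma x) with (Gamma x * digamma x); [field; lra|].
symmetry; apply is_derive_unique.
apply (is_derive_ext_loc (fun z => Gamma x * exp (lgamma z - lgamma x))).
- assert (Hd : 0 < Rmin x 1) by (apply Rmin_glb_lt; lra).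
  exists (mkposreal _ Hd); intros z Hz; simpl in Hz.
  change (Rabs (z - x) < Rmin x 1) in Hz.
  pose proof (Rmin_l x 1); pose proof (Rmin_r x 1).
  symmetry; apply Hnear; [apply Rabs_def2 in Hz|]; lra.
- pose proof (is_derive_lgamma x Hx) as H1.
  auto_derive; [now exists (digamma x)|].
  replace (Derive (fun t => lgamma t) x) with (digamma x)
    by (symmetry; now apply is_derive_unique).
  replace (lgamma x + - lgamma x) with 0 by ring; rewrite exp_0; ring.
Qed.

Lemma locally_pos (x : R) : 0 < x -> locally x (fun y => 0 < y).
Proof.
intros Hx; exists (mkposreal _ Hx); intros y Hy; simpl in Hy.
change (Rabs (y - x) < x) in Hy; apply Rabs_def2 in Hy; lra.
Qed.

(** By induction: the formula holds in a neighbourhood of [x], so it may be differentiated, and each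
    derivative contributes the factor [- INR (S (S m))]. *)
Lemma polygamma_zeta (m : nat) (x : R) : 0 < x ->
  polygamma (S m) x = (-1) ^ m * (INR (fact (S m)) * zeta (S (S m)) x).
Proof.
revert x; induction m as [|m IH]; intros x Hx.
- change (polygamma 1 x) with (Derive psi x).
  rewrite (Derive_ext_loc _ digamma).
  + rewrite (is_derive_unique _ _ _ (is_derive_digamma x Hx)); simpl; ring.
  + apply filter_imp with (2 := locally_pos x Hx), psi_digamma.
- change (polygamma (S (S m)) x) with (Derive (polygamma (S m)) x).
  rewrite (Derive_ext_loc _
    (fun y => (-1) ^ m * (INR (fact (S m)) * zeta (S (S m)) y))).
  + rewrite !Derive_scal, (is_derive_unique _ _ _ (is_derive_zeta m x Hx)).
    rewrite (fact_simpl (S m)), mult_INR; simpl pow; ring.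
  + apply filter_imp with (2 := locally_pos x Hx), IH.
Qed.

(** The factor [INR (S m)] is kept beside [zeta] because the series bounds are stated for that
    product. *)
Lemma signed_polygamma (m : nat) (x : R) : 0 < x ->
  (-1) ^ S (S m) * polygamma (S m) x
    = INR (fact m) * (INR (S m) * zeta (S (S m)) x).
Proof.
intros Hx; rewrite polygamma_zeta, fact_simpl, mult_INR by trivial.
assert (E : (-1) ^ m * (-1) ^ m = 1).
{ rewrite <- Rpow_mult_distr; replace (-1 * -1) with 1 by ring; apply pow1. }
simpl pow; transitivity ((-1) ^ m * (-1) ^ m *
  (INR (S m) * INR (fact m) * zeta (S (S m)) x)); [ring|rewrite E; ring].
Qed.

(** * Transfer of the series estimates to psi and its derivatives *)

Theorem theorem3 :
  forall beta : R, 0 < beta ->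
  (forall (k : nat) (x : R), (1 <= k)%nat -> 0 < x ->
     (ln x - 1 / x <= psi x <= ln x - 1 / (2 * x)) /\
     (INR (fact (k - 1)) / x ^ k + INR (fact k) / (2 * x ^ (k + 1))
        <= (-1) ^ (k + 1) * polygamma k x
        <= INR (fact (k - 1)) / x ^ k + INR (fact k) / x ^ (k + 1))) /\
  (0 < beta ->
   forall (x : R) (k : nat), 0 < x -> (2 <= k)%nat ->
     psi (x + beta) <= ln x + beta / x /\
     (-1) ^ k * polygamma (k - 1) (x + beta)
       >= INR (fact (k - 2)) / x ^ (k - 1)
          - beta * INR (fact (k - 1)) / x ^ k) /\
  (1 / 2 <= beta ->
   forall (x : R) (k : nat), 0 < x -> (2 <= k)%nat ->
     psi (x + beta) >= ln x /\
     (-1) ^ k * polygamma (k - 1) (x + beta)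
       <= INR (fact (k - 2)) / x ^ (k - 1)) /\
  (1 <= beta ->
   forall (x : R) (k : nat), 0 < x -> (2 <= k)%nat ->
     psi (x + beta) <= ln x + (beta - 1 / 2) / x /\
     (-1) ^ k * polygamma (k - 1) (x + beta)
       >= INR (fact (k - 2)) / x ^ (k - 1)
          - (beta - 1 / 2) * INR (fact (k - 1)) / x ^ k).
Proof.
intros beta Hbeta.
assert (Hfact : forall m, 0 <= INR (fact m)) by (intros; apply pos_INR).
split; [|split; [|split]].
- intros k x Hk Hx; destruct k as [|m]; [lia|]; split.
  + rewrite psi_digamma by trivial; now apply digamma_bounds.
  + replace (S m - 1)%nat with m by lia.
    replace (S m + 1)%nat with (S (S m)) by lia.
    rewrite signed_polygamma, fact_simpl, mult_INR by trivial.
    pose proof (zeta_bounds m x Hx) as [Hl Hu].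
    apply (Rmult_le_compat_l _ _ _ (Hfact m)) in Hl.
    apply (Rmult_le_compat_l _ _ _ (Hfact m)) in Hu.
    unfold Rdiv; rewrite Rinv_mult; lra.
- intros _ x k Hx Hk; destruct k as [|[|m]]; try lia.
  replace (S (S m) - 1)%nat with (S m) by lia.
  replace (S (S m) - 2)%nat with m by lia.
  assert (Hxb : 0 < x + beta) by lra.
  split.
  + rewrite psi_digamma by trivial.
    (* Dropping the negative term leaves [ln (x + beta)], which is at most [ln x + beta / x]. *)
    pose proof (digamma_bounds (x + beta) Hxb).
    assert (0 < 1 / (2 * (x + beta))) by (apply Rdiv_lt_0_compat; lra).
    pose proof (ln_sub_bounds x (x + beta) Hx Hxb) as [_ Hl].
    replace (x + beta - x) with beta in Hl by ring; lra.
  + rewrite signed_polygamma, fact_simpl, mult_INR by trivial.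
    (* Only the leading term [/ (x + beta) ^ S m] is kept; the tangent at [x] bounds it from
       below. *)
    pose proof (zeta_bounds m (x + beta) Hxb) as [Hl _].
    pose proof (inv_pow_tangent (S m) x (x + beta) Hx Hxb) as Ht.
    replace (x + beta - x) with beta in Ht by ring.
    assert (0 <= INR (S m) * (/ (x + beta) ^ S (S m) * / 2)).
    { apply Rmult_le_pos; [apply pos_INR|].
      apply Rmult_le_pos; [|lra].
      now apply Rlt_le, Rinv_0_lt_compat, pow_lt. }
    apply Rle_ge.
    apply Rle_trans with (INR (fact m) *
      (/ x ^ S m + - INR (S m) * / x ^ S (S m) * beta)).
    * unfold Rdiv; lra.
    * apply Rmult_le_compat_l; trivial; lra.
- intros Hb x k Hx Hk; destruct k as [|[|m]]; try lia.
  replace (S (S m) - 1)%nat with (S m) by lia.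
  replace (S (S m) - 2)%nat with m by lia.
  split.
  + rewrite psi_digamma by lra; now apply Rle_ge, digamma_half_ge.
  + rewrite signed_polygamma by lra; unfold Rdiv.
    apply Rmult_le_compat_l; trivial; now apply zeta_half_le.
- intros Hb x k Hx Hk; destruct k as [|[|m]]; try lia.
  replace (S (S m) - 1)%nat with (S m) by lia.
  replace (S (S m) - 2)%nat with m by lia.
  replace (x + beta) with (x + 1 + (beta - 1)) by ring.
  split.
  + rewrite psi_digamma by lra.
    (* The slope [zeta 2 (x + 1)] is at most [/ x], and [digamma (x + 1) = digamma x + / x] is at
       most [ln x + 1 / (2 * x)]; together they give [beta - 1 / 2]. *)
    pose proof (digamma_add_le (x + 1) (beta - 1) ltac:(lra) ltac:(lra)).
    pose proof (zeta_half_le 0 x 1 Hx ltac:(lra)) as Hz.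
    rewrite pow_1 in Hz; change (INR 1) with 1 in Hz; rewrite Rmult_1_l in Hz.
    apply (Rmult_le_compat_l (beta - 1)) in Hz; [|lra].
    rewrite digamma_succ in H by trivial.
    pose proof (digamma_bounds x Hx) as [_ Hu].
    replace (1 / (2 * x)) with (/ x * / 2) in Hu by (field; lra).
    unfold Rdiv; lra.
  + rewrite signed_polygamma, fact_simpl, mult_INR by lra.
    pose proof (zeta_add_ge m (x + 1) (beta - 1) ltac:(lra) ltac:(lra)) as Ha.
    pose proof (zeta_half_le (S m) x 1 Hx ltac:(lra)) as Hh.
    pose proof (zeta_bounds m x Hx) as [Hl _].
    rewrite zeta_succ in Ha by trivial.
    apply (Rmult_le_compat_l (beta - 1)) in Hh; [|lra].
    (* The coefficient of [/ x ^ S (S m)] becomes [1 / 2 - 1 - (beta - 1)]: from the trapezoid bound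
       for [zeta] at [x], the shift to [x + 1], and the tangent slope. *)
    assert (Hz : zeta (S (S m)) x - / x ^ S (S m) - (beta - 1) * / x ^ S (S m)
      <= zeta (S (S m)) (x + 1 + (beta - 1))) by lra.
    apply (Rmult_le_compat_l _ _ _ (pos_INR (S m))) in Hz.
    apply Rle_ge.
    apply Rle_trans with (INR (fact m) *
      (/ x ^ S m - (beta - 1 / 2) * (INR (S m) * / x ^ S (S m)))).
    * unfold Rdiv; lra.
    * apply Rmult_le_compat_l; trivial; lra.
Qed.
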